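(* Let $d\in\mathbb{N}$. For all $m\in\mathbb{N}$, $SL_m(\mathcal{S}'(\mathbb{Z}^d))=E_m(\mathcal{S}'(\mathbb{Z}^d))$.
   Context: $\mathbb{N}=\{1,2,3,\dots\}$. For $\mathbf{n}=(n_1,\dots,n_d)\in\mathbb{Z}^d$ write $|\mathbf{n}|_1:=|n_1|+\cdots+|n_d|$. The set $\mathcal{S}'(\mathbb{Z}^d)$ consists of all maps $\mathbf{a}:\mathbb{Z}^d\to\mathbb{C}$ of at most polynomial growth, i.e. such that there exist a real $M>0$ and $k\in\mathbb{N}$ with $|\mathbf{a}(\mathbf{n})|\le M(1+|\mathbf{n}|_1)^k$ for all $\mathbf{n}\in\mathbb{Z}^d$. With pointwise addition and multiplication it is a commutative unital ring. For a commutative unital ring $R$ and $m\in\mathbb{N}$, $SL_m(R)$ is the group of all $m\times m$ matrices over $R$ with determinant $1$. An elementary matrix over $R$ is one of the form $I_m+\alpha\,\mathbf{e}_{ij}$ with $i\ne j$, $\alpha\in R$, where $\mathbf{e}_{ij}$ is the $m\times m$ matrix whose $(i,j)$ entry is $1$ and whose other entries are $0$. $E_m(R)$ is the subgroup of $SL_m(R)$ generated by the elementary matrices. *)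

(* Defs.v *)
From HB Require Import structures.
From mathcomp Require Import all_boot all_order all_algebra.
From mathcomp Require Import all_classical all_reals.
From mathcomp Require Export complex.

Set Implicit Arguments.
Unset Strict Implicit.
Unset Printing Implicit Defensive.

Import Order.TTheory GRing.Theory Num.Theory.

Local Open Scope classical_set_scope.
Local Open Scope ring_scope.
Local Open Scope complex_scope.

(* The complex numbers are R[i], for R any model of the real numbers, and the
   elements of Z^d are the integer row vectors of length d. *)

Definition norm1 (d : nat) (n : 'rV[int]_d) : nat := (\sum_(i < d) `|n ord0 i|)%N.

Definition poly_growth (R : realType) (d : nat) (a : 'rV[int]_d -> R[i]) : Prop :=
  exists (M : R) (k : nat), [/\ 0 < M, (0 < k)%N &
    forall n : 'rV[int]_d, `|a n| <= (M * (1 + (norm1 n)%:R) ^+ k)%:C].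

Definition poly_growth_pred (R : realType) (d : nat) :
    {pred 'rV[int]_d -> R[i]} :=
  fun a => `[< poly_growth a >].

Lemma poly_growth_subring_closed (R : realType) (d : nat) :
  subring_closed (@poly_growth_pred R d).
Proof.
have c1 (x : nat) : 1 <= 1 + x%:R :> R by rewrite lerDl ler0n.
split.
- apply/asboolP; exists 1, 1%N; split => // n.
  by rewrite [X in `|X|]/(1 : R[i]) normr1 mul1r expr1 -[1 in leLHS]/(1%:C) lecR.
- move=> a b /asboolP[M [k [M0 k0 aM]]] /asboolP[N [l [N0 l0 bN]]].
  apply/asboolP; exists (M + N), (k + l)%N; split; first exact: addr_gt0.
    by rewrite addn_gt0 k0.
  move=> n; apply: (le_trans (ler_normB _ _)).
  apply: (le_trans (lerD (aM n) (bN n))).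
  rewrite -rmorphD lecR mulrDl lerD // ler_wpM2l ?(ltW M0) ?(ltW N0) //.
    by rewrite ler_weXn2l ?leq_addr.
  by rewrite ler_weXn2l ?leq_addl.
- move=> a b /asboolP[M [k [M0 k0 aM]]] /asboolP[N [l [N0 l0 bN]]].
  apply/asboolP; exists (M * N), (k + l)%N; split; first exact: mulr_gt0.
    by rewrite addn_gt0 k0.
  move=> n; rewrite [X in `|X|]/(a n * b n) normrM exprD mulrACA rmorphM.
  exact: ler_pM.
Qed.

(* S'(Z^d) as a subring of the ring of all maps Z^d -> C with the pointwise
   operations. *)
Definition tempered (R : realType) (d : nat) : Type :=
  {a : 'rV[int]_d -> R[i] | poly_growth_pred a}.

HB.instance Definition _ (R : realType) (d : nat) :=
  SubChoice.on (tempered R d).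
HB.instance Definition _ (R : realType) (d : nat) :=
  GRing.SubChoice_isSubComPzRing.Build _ (@poly_growth_pred R d) (tempered R d)
    (poly_growth_subring_closed R d).

Lemma tempered_oner_neq0 (R : realType) (d : nat) : 1 != 0 :> tempered R d.
Proof.
apply/eqP => /(congr1 (fun a : tempered R d => \val a 0)) /eqP.
by rewrite rmorph1 rmorph0 oner_eq0.
Qed.

HB.instance Definition _ (R : realType) (d : nat) :=
  GRing.PzSemiRing_isNonZero.Build (tempered R d) (@tempered_oner_neq0 R d).

Definition SL (m : nat) (A : comPzRingType) : set 'M[A]_m :=
  [set X | \det X = 1].
Arguments SL : clear implicits.

Definition elementary (m : nat) (A : comPzRingType) : set 'M[A]_m :=
  [set X | exists (i j : 'I_m) (alpha : A),
    i != j /\ X = 1%:M + alpha *: delta_mx i j].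
Arguments elementary : clear implicits.

(* Inverses are expressed relationally, since invmx requires a unitRingType
   structure on A. *)
Definition SL_subgroup (m : nat) (A : comPzRingType) (H : set 'M[A]_m) : Prop :=
  [/\ H `<=` SL m A,
      H 1%:M,
      forall X Y : 'M[A]_m, H X -> H Y -> H (X *m Y) &
      forall X Y : 'M[A]_m, H X -> X *m Y = 1%:M -> H Y].

(* smallest P G is the intersection of all the sets that satisfy P and
   contain G. *)
Definition E (m : nat) (A : comPzRingType) : set 'M[A]_m :=
  smallest (@SL_subgroup m A) (elementary m A).
Arguments E : clear implicits.

(* Main.v *)
(** A commutative ring satisfies Bass' stable range condition 1 when [x a + y b
    = 1] implies that [a + t b] is a unit for some [t]; over such a ring every
    matrix of determinant 1 is reduced to the identity by elementary operations.
    S'(Z^d) satisfies the condition: pointwise, take [t = 0] where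
    [|b| <= |a|] and [t = 2] elsewhere. Then [|a + t b| >= max(|a|, |b|)], and
    [1 <= (|x| + |y|) max(|a|, |b|)], so the pointwise inverse of [a + t b] is
    bounded by [|x| + |y|]. *)

Require Import Defs.
From HB Require Import structures.
From mathcomp Require Import all_boot all_order all_algebra.
From mathcomp Require Import all_classical all_reals.

Local Open Scope classical_set_scope.
Local Open Scope ring_scope.

Import Order.TTheory GRing.Theory Num.Theory.

Definition stable_range1 (A : comPzRingType) : Prop :=
  forall a b x y : A, x * a + y * b = 1 -> exists t v, (a + t * b) * v = 1.

Lemma delta_mx_block_ur (A : pzSemiRingType) (p q : nat) (i : 'I_p) (j : 'I_q) :
  delta_mx (lshift q i) (rshift p j) = block_mx 0 (delta_mx i j) 0 0 :> 'M[A]_(p + q).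
Proof. by rewrite delta_mx_ushift delta_mx_rshift block_mxEv row_mx0. Qed.

Lemma delta_mx_block_dl (A : pzSemiRingType) (p q : nat) (i : 'I_p) (j : 'I_q) :
  delta_mx (rshift p j) (lshift q i) = block_mx 0 0 (delta_mx j i) 0 :> 'M[A]_(p + q).
Proof. by rewrite delta_mx_dshift delta_mx_lshift block_mxEv row_mx0. Qed.

(** * Gaussian elimination by block transvections *)

Section Elimination.
Variable A : comPzRingType.

(** Closure under products is enough for elimination: the inverse of a block transvection is the one
    with the opposite block. *)
Definition elementary_monoid (m : nat) (H : set 'M[A]_m) : Prop :=
  [/\ H 1%:M, forall X Y, H X -> H Y -> H (X *m Y) & elementary m A `<=` H].

Section Blocks.
Variables (p q : nat) (H : set 'M[A]_(p + q)).
Hypothesis HH : elementary_monoid _ H.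

(** Multiplying block transvections adds their blocks, and [U] is a sum of scaled matrix units, each
    of which gives an elementary matrix. *)
Lemma elementary_monoid_ur (U : 'M[A]_(p, q)) : H (block_mx 1%:M U 0 1%:M).
Proof.
have [H1 HM HE] := HH.
have HD V W : H (block_mx 1%:M V 0 1%:M) -> H (block_mx 1%:M W 0 1%:M) ->
    H (block_mx 1%:M (V + W) 0 1%:M).
  move=> HV HW; have := HM _ _ HW HV.
  by rewrite mulmx_block !(mul1mx, mulmx1, mul0mx, mulmx0, addr0, add0r).
have H0 : H (block_mx 1%:M 0 0 1%:M) by rewrite -scalar_mx_block.
rewrite [U]matrix_sum_delta.
elim/big_ind: _ => [//|V W|i _]; first exact: HD.
elim/big_ind: _ => [//|V W|j _]; first exact: HD.
apply: HE; exists (lshift q i), (rshift p j), (U i j).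
by rewrite eq_lrshift delta_mx_block_ur scale_block_mx !scaler0
           scalar_mx_block add_block_mx !(addr0, add0r).
Qed.

Lemma elementary_monoid_dl (U : 'M[A]_(q, p)) : H (block_mx 1%:M 0 U 1%:M).
Proof.
have [H1 HM HE] := HH.
have HD V W : H (block_mx 1%:M 0 V 1%:M) -> H (block_mx 1%:M 0 W 1%:M) ->
    H (block_mx 1%:M 0 (V + W) 1%:M).
  move=> HV HW; have := HM _ _ HV HW.
  by rewrite mulmx_block !(mul1mx, mulmx1, mul0mx, mulmx0, addr0, add0r).
have H0 : H (block_mx 1%:M 0 0 1%:M) by rewrite -scalar_mx_block.
rewrite [U]matrix_sum_delta.
elim/big_ind: _ => [//|V W|i _]; first exact: HD.
elim/big_ind: _ => [//|V W|j _]; first exact: HD.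
apply: HE; exists (rshift p i), (lshift q j), (U i j).
by rewrite eq_rlshift delta_mx_block_dl scale_block_mx !scaler0
           scalar_mx_block add_block_mx !(addr0, add0r).
Qed.

(** This permits backward reasoning: the goal [H X] may be replaced by the same goal after a row
    operation, which [- U] undoes. *)
Lemma elementary_monoid_mul_ur (U : 'M[A]_(p, q)) (X : 'M[A]_(p + q)) :
  H (block_mx 1%:M U 0 1%:M *m X) -> H X.
Proof.
move=> HX; have [_ HM _] := HH.
have := HM _ _ (elementary_monoid_ur (- U)) HX.
rewrite mulmxA mulmx_block !(mul1mx, mulmx1, mul0mx, mulmx0, addr0, add0r) subrr.
by rewrite -scalar_mx_block mul1mx.
Qed.

Lemma elementary_monoid_mul_dl (U : 'M[A]_(q, p)) (X : 'M[A]_(p + q)) :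
  H (block_mx 1%:M 0 U 1%:M *m X) -> H X.
Proof.
move=> HX; have [_ HM _] := HH.
have := HM _ _ (elementary_monoid_dl (- U)) HX.
rewrite mulmxA mulmx_block !(mul1mx, mulmx1, mul0mx, mulmx0, addr0, add0r) addNr.
by rewrite -scalar_mx_block mul1mx.
Qed.

(** This is what lets the elimination recurse on a smaller matrix. *)
Lemma elementary_monoid_corner :
  elementary_monoid _ [set S : 'M[A]_q | H (block_mx 1%:M 0 0 S)].
Proof.
have [H1 HM HE] := HH; split => [|S T HS HT|S [i [j [a [ij ->]]]]] /=.
- by rewrite -scalar_mx_block.
- have -> : block_mx 1%:M 0 0 (S *m T) = block_mx (1%:M : 'M_p) 0 0 S *m block_mx 1%:M 0 0 T.
    by rewrite mulmx_block !(mul1mx, mulmx1, mul0mx, mulmx0, addr0, add0r).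
  exact: HM.
- apply: HE; exists (rshift p i), (rshift p j), a; rewrite eq_rshift; split=> //.
  rewrite delta_mx_dshift delta_mx_rshift -row_mx0 -block_mxEv scale_block_mx.
  by rewrite !scaler0 scalar_mx_block add_block_mx !(addr0, add0r).
Qed.

End Blocks.

Hypothesis sr1 : stable_range1 A.

(** Induction on the size, with [H] arbitrary so that the induction hypothesis applies to the set of
    corners [S] of the block matrices in [H]. *)
Lemma elementary_monoid_SL (m : nat) (H : set 'M[A]_m) :
  elementary_monoid _ H -> SL m A `<=` H.
Proof.
elim: m H => [|m IHm] H HH X /= detX.
  by have [H1 _ _] := HH; rewrite [X]thinmx0 -[0](thinmx0 1%:M).
(* Size 1 is set apart, since the elimination below uses a second row. *)
case: m => [|m] in IHm H HH X detX *.
  have [H1 _ _] := HH; suff -> : X = 1%:M by [].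
  by apply/matrixP=> i j; rewrite !ord1 mxE /= -detX det_mx11.
have HHb : elementary_monoid (1 + m.+1) H := HH.
move: X detX; change (forall X : 'M[A]_(1 + m.+1), \det X = 1 -> H X) => X.
have det_ur U : \det (block_mx 1%:M U 0 1%:M : 'M[A]_(1 + m.+1)) = 1.
  by rewrite det_ublock !det1 mulr1.
have det_dl U : \det (block_mx 1%:M 0 U 1%:M : 'M[A]_(1 + m.+1)) = 1.
  by rewrite det_lblock !det1 mulr1.
(* First make the top left entry a unit. Cofactor expansion along the first column gives
   [k * X 0 0 + 1 * s = 1], and stable range makes [X 0 0 + t * s] invertible; the row [c] of
   cofactors scaled by [t] adds exactly [t * s] to that entry. *)
wlog [r ur] : X / exists r, ulsubmx X 0 0 * r = 1.
  move=> IH detX.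
  move: (detX); rewrite (expand_det_col _ (lshift m.+1 (0 : 'I_1))) big_split_ord /=.
  rewrite big_ord1 mulrC; set k := cofactor _ _ _; set s := \sum_(_ < _) _.
  rewrite -[s]mul1r => /sr1[t [r tr]].
  pose c := \row_i (t * cofactor X (rshift 1 i) (lshift m.+1 0)).
  apply: (elementary_monoid_mul_ur _ _ _ HHb c); apply: IH; last first.
    by rewrite det_mulmx det_ur detX mulr1.
  exists r; rewrite -[RHS]tr; congr (_ * r).
  rewrite -[X]submxK mulmx_block block_mxKul mul1mx submxK !mxE; congr (_ + _).
  rewrite mulr_sumr; apply: eq_bigr => i _.
  by rewrite !mxE mulrAC mulrA.
(* With a unit at the top, the rest of the first column can be given any value. All ones, rather
   than zeros, lets the next step correct the top entry. *)
wlog dlX : X r ur / dlsubmx X = const_mx 1.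
  move=> IH detX.
  pose c := const_mx 1 - dlsubmx X.
  apply: (elementary_monoid_mul_dl _ _ _ HHb (c *m r%:M)); apply: (IH _ r); last first.
  - by rewrite det_mulmx det_dl detX mulr1.
  - rewrite -[X]submxK mulmx_block block_mxKdl mul1mx.
    rewrite [ulsubmx X]mx11_scalar -mulmxA -scalar_mxM mulrC ur mulmx1.
    by rewrite subrK.
  - by rewrite -[X]submxK mulmx_block block_mxKul mul1mx mul0mx addr0.
(* Adding [1 - ulsubmx X 0 0] times the second row, whose first entry is 1, turns the top left entry
   into 1. *)
wlog ulX : X r ur dlX / ulsubmx X = 1%:M.
  move=> IH detX.
  pose c := ((1 - ulsubmx X 0 0) *: delta_mx 0 0 : 'rV_m.+1).
  apply: (elementary_monoid_mul_ur _ _ _ HHb c).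
  have ul1 : ulsubmx (block_mx 1%:M c 0 1%:M *m X) = 1%:M.
    rewrite -[X]submxK mulmx_block block_mxKul mul1mx dlX.
    rewrite [ulsubmx X]mx11_scalar [c *m _]mx11_scalar -raddfD /= -scalemxAl -rowE.
    by rewrite !mxE mulr1 addrC subrK.
  apply: (IH _ 1) => //; last by rewrite det_mulmx det_ur detX mulr1.
  - by rewrite ul1 mxE mulr1.
  - by rewrite -[X]submxK mulmx_block block_mxKdl mul1mx mul0mx add0r.
(* Subtracting the first row from all the others clears the column. What remains factors through the
   Schur complement [S], whose determinant is 1. *)
move=> detX; apply: (elementary_monoid_mul_dl _ _ _ HHb (- const_mx 1)).
set S := drsubmx X - const_mx 1 *m ursubmx X.
have XE : block_mx 1%:M 0 (- const_mx 1) 1%:M *m X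
       = block_mx 1%:M 0 0 S *m block_mx 1%:M (ursubmx X) 0 1%:M.
  rewrite -[X in LHS]submxK ulX dlX !mulmx_block.
  rewrite !(mul1mx, mulmx1, mul0mx, mulmx0, addr0, add0r) addNr mulNmx.
  by rewrite [- _ + _]addrC.
have [_ HM _] := HH; rewrite XE; apply: HM; last exact: elementary_monoid_ur.
apply: (IHm _ (elementary_monoid_corner _ _ _ HHb)) => /=.
move/(congr1 determinant): XE.
by rewrite !det_mulmx det_dl det_ur detX det_ublock det1 !mulr1 mul1r.
Qed.

End Elimination.

(** * Comparison of [SL] with [E] *)

Lemma det_transvection (A : comPzRingType) (m : nat) (i j : 'I_m) (a : A) :
  i != j -> \det (1%:M + a *: delta_mx i j) = 1.
Proof.
(* Below the diagonal the matrix is lower triangular with unit diagonal; the other case follows by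
   transposition. *)
have trig (k l : 'I_m) : (l < k)%N -> \det (1%:M + a *: delta_mx k l) = 1.
  move=> lk; rewrite det_trig.
    rewrite big1 // => p _; rewrite !mxE eqxx.
    case: eqP => [->|_]; last by rewrite mulr0 addr0.
    by rewrite eq_sym -val_eqE /= (ltn_eqF lk) mulr0 addr0.
  apply/is_trig_mxP => p q pq; rewrite !mxE -val_eqE (ltn_eqF pq) add0r.
  case: eqP => [pk|]; last by rewrite mulr0.
  case: eqP => [ql|]; last by rewrite mulr0.
  by move: pq; rewrite pk ql ltnNge (ltnW lk).
rewrite -val_eqE neq_ltn => /orP[ij|]; last exact: trig.
by rewrite -det_tr linearD /= linearZ /= trmx1 trmx_delta trig.
Qed.

(** This makes [SL m A] one of the sets whose intersection is [E m A]. *)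
Lemma SL_subgroup_SL (A : comPzRingType) (m : nat) : SL_subgroup (SL m A).
Proof.
rewrite /SL; split => [X //||X Y|X Y] /=; first exact: det1.
- by move=> X1 Y1; rewrite det_mulmx X1 Y1 mulr1.
- by move=> X1 /(congr1 determinant); rewrite det_mulmx X1 mul1r => ->; exact: det1.
Qed.

Lemma stable_range1_SL_E (A : comPzRingType) (m : nat) :
  stable_range1 A -> SL m A = E m A.
Proof.
move=> sr1; apply/seteqP; split => [X detX H [[_ H1 HM _] HE]|].
  by apply: (elementary_monoid_SL _ sr1 _ _ _ _ detX); split.
apply: smallest_sub; first exact: SL_subgroup_SL.
by move=> _ [i [j [a [ij ->]]]] /=; exact: det_transvection.
Qed.

(** * Stable range 1 for sequences of polynomial growth *)

Section Tempered.
Variables (R : realType) (d : nat).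
Local Notation T := (tempered R d).

(** The growth criterion applied both to the multiplier [t0] and to the pointwise inverse. As the
    base [1 + norm1 n] is at least 1, both bounds can be raised to the exponent [k + l]. *)
Lemma tempered_dominated (x y : T) (f : 'rV[int]_d -> R[i]) :
  (forall n, `|f n| <= `|\val x n| + `|\val y n|) -> poly_growth_pred f.
Proof.
move=> fxy; have /asboolP[M [k [M0 k0 xM]]] := valP x.
have /asboolP[N [l [N0 l0 yN]]] := valP y.
have c1 n : 1 <= 1 + (norm1 n)%:R :> R by rewrite lerDl ler0n.
apply/asboolP; exists (M + N), (k + l)%N; split; first exact: addr_gt0.
  by rewrite addn_gt0 k0.
move=> n; rewrite (le_trans (fxy n)) // (le_trans (lerD (xM n) (yN n))) //.
rewrite -rmorphD lecR mulrDl lerD // ler_wpM2l ?(ltW M0) ?(ltW N0) //.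
  by rewrite ler_weXn2l ?leq_addr.
by rewrite ler_weXn2l ?leq_addl.
Qed.

Lemma tempered_stable_range1 : stable_range1 T.
Proof.
move=> a b x y xayb.
have xaybn n : \val x n * \val a n + \val y n * \val b n = 1.
  by move/(congr1 (fun c : T => \val c n)): xayb; rewrite rmorph1 rmorphD !rmorphM.
pose t0 n : R[i] := if `|\val b n| <= `|\val a n| then 0 else 2.
have t_growth : poly_growth_pred t0.
  apply: (tempered_dominated 1 1) => n; rewrite rmorph1 /= normr1 /t0.
  by rewrite -[1 + 1]/(2%:R); case: ifP => _; rewrite ?normr0 ?normr_nat.
pose t : T := Sub t0 t_growth.
pose c := a + t * b.
have cE n : \val c n = \val a n + \val t n * \val b n.
  by rewrite rmorphD rmorphM.
have c_ge n : `|\val a n| <= `|\val c n| /\ `|\val b n| <= `|\val c n|.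
  rewrite cE /= /t0; case: ifPn => [ba|]; first by rewrite mul0r addr0.
  (* The order on the complex numbers is partial; the negation becomes a strict inequality because
     norms are real. *)
  rewrite -real_ltNge ?normr_real // => ab.
  suff bc : `|\val b n| <= `|\val a n + 2 * \val b n|.
    by rewrite bc (le_trans (ltW ab) bc).
  (* Writing [2 b] as [(a + 2 b) - a] gives [2 |b| <= |a + 2 b| + |a| <= |a + 2 b| + |b|]. *)
  rewrite -(lerD2r `|\val b n|) -mulr2n -[leLHS]mulr_natl -[2%:R in leLHS]normr_nat.
  rewrite -normrM -[X in `|X| <= _](addrK (\val a n)) (le_trans (ler_normB _ _)) //.
  by rewrite [X in `|X| + _ <= _]addrC lerD2l ltW.
have c_ge1 n : 1 <= (`|\val x n| + `|\val y n|) * `|\val c n|.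
  have [ac bc] := c_ge n.
  rewrite -[1](normr1 R[i]) -(xaybn n) mulrDl (le_trans (ler_normD _ _)) //.
  by rewrite !normrM lerD // ler_wpM2l.
have c_neq0 n : \val c n != 0.
  by apply: contraTneq (c_ge1 n) => ->; rewrite normr0 mulr0 ler10.
(* Dividing [c_ge1] by the norm of [c] bounds the inverse by the norms of the Bezout coefficients
   [x] and [y]. *)
have v_growth : poly_growth_pred (fun n => (\val c n)^-1).
  apply: (tempered_dominated x y) => n.
  by rewrite normfV -[leLHS]mul1r ler_pdivrMr ?normr_gt0.
exists t, (Sub _ v_growth); apply: val_inj; apply/funext => n.
by rewrite rmorphM rmorph1; exact: divff (c_neq0 n).
Qed.
End Tempered.

Theorem theorem8p3 (R : realType) (d : nat) (hd : (0 < d)%N) :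
  forall m : nat, (0 < m)%N -> SL m (tempered R d) = E m (tempered R d).
Proof. by move=> m _; apply: stable_range1_SL_E; exact: tempered_stable_range1. Qed.
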